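(* Let $n \geq 4$ and let $H$ be a graph with a unique vertex $v$ of maximum degree, this maximum degree being $n+1$, such that $H - v$ has maximum degree at most $n-1$. Let $H'$ be the graph obtained from $H$ by an $(n+1)$-subdivision. Then there is $k \in \mathbb{N}$ such that $\square^n K_k$ is $H'$-induced-saturated.
   Context: All graphs are finite and simple; $\mathbb{N}=\{1,2,\dots\}$. For graphs $H,G$, write $H \subseteq_I G$ if $G$ contains an induced subgraph isomorphic to $H$. A graph $G$ on at least two vertices is $H$-induced-saturated if $H \not\subseteq_I G$, but $H \subseteq_I G - e$ for every edge $e \in E(G)$ and $H \subseteq_I G + e$ for every edge $e \in E(\overline{G})$ of the complement. $\square^n K_k$ is the Cartesian product of $n$ cliques of order $k$: its vertices are all $n$-tuples with entries in a fixed $k$-element set, two tuples being adjacent iff they differ in exactly one coordinate. A graph $H'$ is obtained from $H$ by a $k$-subdivision if $V(H')$ is the disjoint union of $V(H)$ and sets $V_e$, $e \in E(H)$, where for each $xy \in E(H)$ we have $|V_{xy}| = k$ and $V_{xy}\cup\{x,y\}$ induces a path with endpoints $x$ and $y$, and there are no other edges in $H'$ (i.e. each edge of $H$ is subdivided with $k$ new vertices). *)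

(* Defs.v *)
From mathcomp Require Import all_boot.

Set Implicit Arguments.
Unset Strict Implicit.
Unset Printing Implicit Defensive.

Record sgraph := SGraph {
  vertex :> finType;
  adj : rel vertex;
  adj_sym : symmetric adj;
  adj_irrefl : irreflexive adj }.

Arguments adj {s} x y.

(* Edges are unordered pairs, i.e. two-element vertex sets. *)
Definition edges (G : sgraph) : {set {set G}} :=
  [set e | [exists x : G, exists y : G, adj x y && (e == [set x; y])]].

Definition deg (G : sgraph) (x : G) : nat := #|[set y : G | adj x y]|.

Definition max_degree (G : sgraph) : nat := \max_(x : G) deg x.

Definition iso (G1 G2 : sgraph) : Prop :=
  exists f : G1 -> G2,
    bijective f /\ forall x y : G1, adj (f x) (f y) = adj x y.

Section Operations.
Variable G : sgraph.

Section Induced.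
Variable A : {set G}.
Definition induced_adj : rel {x : G | x \in A} :=
  fun x y => adj (val x) (val y).
Lemma induced_sym : symmetric induced_adj.
Proof. by move=> x y; rewrite /induced_adj adj_sym. Qed.
Lemma induced_irrefl : irreflexive induced_adj.
Proof. by move=> x; rewrite /induced_adj adj_irrefl. Qed.
Definition induced : sgraph := SGraph induced_sym induced_irrefl.
End Induced.

Definition delete_vertex (v : G) : sgraph := induced [set~ v].

Definition compl_adj : rel G := fun x y => (x != y) && ~~ adj x y.
Lemma compl_sym : symmetric compl_adj.
Proof. by move=> x y; rewrite /compl_adj eq_sym adj_sym. Qed.
Lemma compl_irrefl : irreflexive compl_adj.
Proof. by move=> x; rewrite /compl_adj eqxx. Qed.
Definition compl : sgraph := SGraph compl_sym compl_irrefl.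

Section Edge.
Variable e : {set G}.

Definition delete_edge_adj : rel G := fun x y => adj x y && ([set x; y] != e).
Lemma delete_edge_sym : symmetric delete_edge_adj.
Proof. by move=> x y; rewrite /delete_edge_adj adj_sym setUC. Qed.
Lemma delete_edge_irrefl : irreflexive delete_edge_adj.
Proof. by move=> x; rewrite /delete_edge_adj adj_irrefl. Qed.
Definition delete_edge : sgraph := SGraph delete_edge_sym delete_edge_irrefl.

Definition add_edge_adj : rel G :=
  fun x y => adj x y || ((x != y) && ([set x; y] == e)).
Lemma add_edge_sym : symmetric add_edge_adj.
Proof. by move=> x y; rewrite /add_edge_adj adj_sym eq_sym setUC. Qed.
Lemma add_edge_irrefl : irreflexive add_edge_adj.
Proof. by move=> x; rewrite /add_edge_adj adj_irrefl eqxx. Qed.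
Definition add_edge : sgraph := SGraph add_edge_sym add_edge_irrefl.
End Edge.

End Operations.

Definition induced_sub (H G : sgraph) : Prop :=
  exists A : {set G}, iso H (induced A).

Definition induced_saturated (H G : sgraph) : Prop :=
  [/\ 2 <= #|G|,
      ~ induced_sub H G,
      forall e : {set G}, e \in edges G -> induced_sub H (delete_edge e)
    & forall e : {set G}, e \in edges (compl G) ->
        induced_sub H (add_edge e)].

Section CliqueProduct.
Variables n k : nat.
Definition clique_product_adj : rel (n.-tuple 'I_k) :=
  fun s t => #|[set i : 'I_n | tnth s i != tnth t i]| == 1.
Lemma clique_product_sym : symmetric clique_product_adj.
Proof.
move=> s t; rewrite /clique_product_adj; congr (_ == _).
by apply: eq_card => i; rewrite !inE eq_sym.
Qed.
Lemma clique_product_irrefl : irreflexive clique_product_adj.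
Proof.
move=> s; rewrite /clique_product_adj (_ : [set i | _] = set0) ?cards0 //.
by apply/setP => i; rewrite !inE eqxx.
Qed.
Definition clique_product : sgraph :=
  SGraph clique_product_sym clique_product_irrefl.
End CliqueProduct.

(* The subgraph of G induced by A is a path with endpoints x and y; x :: p    *)
(* lists its vertices in order.                                               *)
Definition induces_path (G : sgraph) (A : {set G}) (x y : G) : Prop :=
  exists p : seq G,
    [/\ uniq (x :: p), x :: p =i A, last x p = y
      & forall i j, i < size (x :: p) -> j < size (x :: p) ->
          adj (nth x (x :: p) i) (nth x (x :: p) j)
          = (j == i.+1) || (i == j.+1)].

(* f embeds V(H) into V(H'), and V e is only relevant for e \in edges H. The  *)
(* first four conditions say that V(H') is the disjoint union of V(H) and the *)
(* sets V e, the last one that H' has no edges besides those of the paths.    *)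
Definition is_subdivision (k : nat) (H H' : sgraph) : Prop :=
  exists (f : H -> H') (V : {set H} -> {set H'}),
    [/\ injective f,
        forall (x : H) (e : {set H}), e \in edges H -> f x \notin V e,
        forall e1 e2 : {set H}, e1 \in edges H -> e2 \in edges H ->
          e1 != e2 -> [disjoint V e1 & V e2]
      & forall w : H', (exists x : H, w = f x) \/
          (exists2 e : {set H}, e \in edges H & w \in V e)]
    /\
    [/\ forall e : {set H}, e \in edges H -> #|V e| = k,
        forall x y : H, adj x y ->
          induces_path (V [set x; y] :|: [set f x; f y]) (f x) (f y)
      & forall w z : H', adj w z ->
          exists x y : H, [/\ adj x y,
            w \in V [set x; y] :|: [set f x; f y]
          & z \in V [set x; y] :|: [set f x; f y]]].

(* Main.v *)
(* Let the alphabet consist of V(H) and two private labels for each edge of H,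
   and map a vertex x of H to the constant tuple (x, ..., x).  The path of an
   edge e = xy is mapped to a walk of n + 2 steps from (x, ..., x) to
   (y, ..., y): every coordinate is changed from x to y, possibly via a private
   label of e, and all inner vertices keep at least two private labels, except
   the first and the last one, which may have a single one.  Hence vertices on
   different paths are at Hamming distance at least 2, unless both are end
   vertices attached to the same x in the same direction.  So it is enough to
   give the half-edges at every vertex different directions, which is possible
   except at v, where one of the n + 1 edges, vu0, is left over.

   If an edge is removed, the path of vu0 may start in the same direction as
   another path at v, the edge between the two first inner vertices being the
   removed one.  If an edge is added, it serves as the first step of the path of
   vu0, which then may change any set of at least two coordinates at once.
   Finally, H' is not induced in the product, because among n + 1 neighbours
   of a vertex two lie in the same of the n cliques. *)

Require Import Defs.
From mathcomp Require Import all_boot perm.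

Set Implicit Arguments.
Unset Strict Implicit.
Unset Printing Implicit Defensive.

(** * Hamming distance *)

Section Hamming.
Variables (n : nat) (L : eqType).
Implicit Types s t : 'I_n -> L.

Definition hamming s t : nat := #|[set i | s i != t i]|.

Lemma hammingC s t : hamming s t = hamming t s.
Proof. by apply: eq_card => i; rewrite !inE eq_sym. Qed.

Lemma hamming_gt0 s t i : s i != t i -> 0 < hamming s t.
Proof. by move=> ne; apply/card_gt0P; exists i; rewrite inE. Qed.

Lemma hamming_eq1 s t i :
  s i != t i -> (forall j, j != i -> s j = t j) -> hamming s t = 1.
Proof.
move=> ne eq; apply/eqP/cards1P; exists i; apply/setP => j; rewrite !inE.
by case: (eqVneq j i) => [->//|/eq ->]; rewrite eqxx.
Qed.

Lemma hamming_gt1 s t i j :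
  i != j -> s i != t i -> s j != t j -> 1 < hamming s t.
Proof. by move=> ij si sj; apply/card_gt1P; exists i, j; rewrite !inE. Qed.

End Hamming.

(** * Points of the subdivided graph and their codes *)

Section Subdivision.
Variables (V E : eqType) (src tgt : E -> V) (k : nat).

Definition point : Type := (V + E * nat)%type.

(* (e, i) is the inner vertex number i of the path of e, counted from 0. *)
Definition valid (X : point) : bool := if X is inr (_, i) then i < k else true.

Definition point_adj (X Y : point) : bool :=
  match X, Y with
  | inl _, inl _ => false
  | inl x, inr (e, i) | inr (e, i), inl x =>
      (x == src e) && (i == 0) || (x == tgt e) && (i.+1 == k)
  | inr (e, i), inr (e', j) => (e == e') && ((j == i.+1) || (i == j.+1))
  end.

Lemma point_adjC X Y : point_adj X Y = point_adj Y X.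
Proof.
case: X Y => [x|[e i]] [y|[e' j]] //=.
by rewrite eq_sym orbC.
Qed.

End Subdivision.

(* The path of e starts by writing private labels on the coordinates in D e
   (ordinarily a single one) and ends in direction b e. Before that, one more
   coordinate receives a private label, so that b e and c e both carry one; then
   the coordinates are set to the target in the order r e, where c e and b e are
   the last two. *)
Section Code.
Variables (V E : eqType) (src tgt : E -> V) (n : nat).
Variables (D : E -> {set 'I_n}) (b c : E -> 'I_n) (r : E -> 'I_n -> 'I_n).
Hypothesis n_ge3 : 2 < n.
Hypothesis src_tgt : forall e, src e != tgt e.
Hypothesis r_inj : forall e, injective (r e).
Hypothesis r_b : forall e, (r e (b e)).+1 = n.
Hypothesis r_c : forall e, (r e (c e)).+2 = n.
Hypothesis D_b_c : forall e, (b e \in D e) || (c e \in D e).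

Local Notation label := (V + E * bool)%type.
Local Notation point := (point V E).
Local Notation valid := (@valid V E n.+1).
Local Notation point_adj := (point_adj src tgt n.+1).

(** The coordinate changed by the step from number 0 to number 1. It may already carry [(e, false)],
    hence the second private label. After that step [b e] and [c e] both carry private labels of
    [e]. *)
Definition pivot e : 'I_n := if b e \in D e then c e else b e.

(* The code of the inner vertex number m = 0, ..., n of the path of e. *)
Definition path_code e m : 'I_n -> label := fun i =>
  if (r e i).+2 <= m then inl (tgt e)
  else if (0 < m) && (i == pivot e) then inr (e, true)
  else if i \in D e then inr (e, false)
  else inl (src e).

Definition code (X : point) : 'I_n -> label :=
  match X with inl x => fun=> inl x | inr (e, i) => path_code e i end.

Definition own e (t : label) : bool :=
  if t is inr (e', _) then e' == e else false.

(* The code of (e, m) is (u, ..., u) with a private label in direction a. *)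
Definition is_end e m (u : V) (a : 'I_n) : Prop :=
  m = 0 /\ u = src e /\ D e = [set a] \/ m = n /\ u = tgt e /\ a = b e.

(* The pairs for which the codes may fail to reflect adjacency. *)
Definition exceptional (X Y : point) : Prop :=
  match X, Y with
  | inl _, inl _ => False
  | inl x, inr (e, i) | inr (e, i), inl x =>
      [/\ i = 0, x = src e & #|D e| != 1]
  | inr (e, i), inr (e', j) =>
      e != e' /\ exists u a, is_end e i u a /\ is_end e' j u a
  end.

Lemma exceptionalC X Y : exceptional X Y -> exceptional Y X.
Proof.
case: X Y => [x|[e i]] [y|[e' j]] //= [ne [u [a [h1 h2]]]].
by rewrite eq_sym; split=> //; exists u, a.
Qed.

(** * Shape of the path codes *)

Lemma b_neq_c e : b e != c e.
Proof.
by apply/eqP => bc; have := r_c e; rewrite -bc => /esym/(etrans (r_b e))/n_Sn.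
Qed.

Lemma r_surj e m : m < n -> exists i, r e i = m :> nat.
Proof. by move=> mn; exists (invF (@r_inj e) (Ordinal mn)); rewrite f_invF. Qed.

Lemma r_neq e i : i != b e -> (r e i).+1 < n.
Proof.
move=> ib; rewrite ltn_neqAle ltn_ord andbT; apply: contra ib => /eqP h.
by have [/val_inj/r_inj ->] := etrans h (esym (r_b e)).
Qed.

Lemma other_coord (i : 'I_n) : exists j, j != i.
Proof.
have n0 : 0 < n by apply: leq_trans n_ge3.
have n1 : 1 < n by apply: leq_trans n_ge3.
case: (eqVneq i (Ordinal n0)) => [->|h]; first by exists (Ordinal n1).
by exists (Ordinal n0); rewrite eq_sym.
Qed.

Lemma own_b e m : 0 < m <= n -> own e (path_code e m (b e)).
Proof.
case/andP=> m0 mn; rewrite /path_code ltnNge r_b mn /= m0 /pivot /=.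
by case: (b e \in D e); [case: ifP|]; rewrite ?eqxx /= eqxx.
Qed.

Lemma own_c e m : 0 < m < n -> own e (path_code e m (c e)).
Proof.
case/andP=> m0 mn; rewrite /path_code r_c leqNgt mn /= m0 /pivot /=.
have := D_b_c e; case: (b e \in D e) => /=; first by rewrite eqxx /= eqxx.
by move=> ->; case: ifP; rewrite /= eqxx.
Qed.

Lemma path_code0 e i :
  path_code e 0 i = if i \in D e then inr (e, false) else inl (src e).
Proof. by []. Qed.

Lemma path_code_last e i : i != b e -> path_code e n i = inl (tgt e).
Proof. by move=> ib; rewrite /path_code r_neq. Qed.

Lemma is_end_code e m u a : is_end e m u a ->
  own e (path_code e m a) /\ forall i, i != a -> path_code e m i = inl u.
Proof.
case=> [[-> [-> Da]]|[-> [-> ->]]]; split.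
- by rewrite path_code0 Da inE eqxx /=.
- by move=> i ia; rewrite path_code0 Da inE (negbTE ia).
- by apply: own_b; rewrite leqnn (leq_trans _ n_ge3).
- exact: path_code_last.
Qed.

(** Two private labels force distance at least 2 from every code off the path, so only ends need
    care. For [0 < m < n] both [b e] and [c e] are private; at [m = n] only [b e] is left, and at
    [m = 0] the private coordinates form [D e]. *)
Lemma path_code_shape e m : m <= n ->
  (exists i j, [/\ i != j, own e (path_code e m i) & own e (path_code e m j)])
  \/ exists u a, is_end e m u a.
Proof.
move=> mn; case: (posnP m) => [->|m0]; last first.
  case: (ltngtP m n) mn => // [mn _|-> _].
    left; exists (b e), (c e); split; first exact: b_neq_c.
      by apply: own_b; rewrite m0 ltnW.
    by apply: own_c; rewrite m0.
  by right; exists (tgt e), (b e); right.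
have ownD i : i \in D e -> own e (path_code e 0 i).
  by rewrite path_code0 => -> /=.
have [a aD] : exists a, a \in D e.
  by case/orP: (D_b_c e) => h; [exists (b e)|exists (c e)].
case: (boolP (D e == [set a])) => [/eqP Da|nDa].
  by right; exists (src e), a; left.
left; have /subsetPn[j jD] : ~~ (D e \subset [set a]).
  by apply: contra nDa => h; rewrite eqEsubset h sub1set.
by rewrite inE => ja; exists j, a; split=> //; apply: ownD.
Qed.

Lemma own_neq_inl e t x : own e t -> inl x != t.
Proof. by case: t. Qed.

Lemma own_path_neq e e' m t i : e != e' -> own e t -> t != path_code e' m i.
Proof.
case: t => // -[e1 q] /= ee' /eqP ->; rewrite /path_code.
have ne q' : inr (e, q) != inr (e', q') :> label.
  by apply: contra ee' => /eqP[->].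
by do !case: ifP => _ //.
Qed.

Lemma is_end_adj e m u a z : is_end e m u a ->
  point_adj (inl z) (inr (e, m)) = (z == u).
Proof.
have n0 : 0 < n by apply: leq_trans n_ge3.
move=> [[-> [-> Da]]|[-> [-> _]]] /=.
  by rewrite eqSS (ltn_eqF n0) andbT andbF orbF.
by rewrite eqxx (gtn_eqF n0) andbF andbT.
Qed.

Lemma adj_is_end e m x :
  ~ exceptional (inl x) (inr (e, m)) ->
  point_adj (inl x) (inr (e, m)) -> exists a, is_end e m x a.
Proof.
move=> /= ex /orP[/andP[/eqP xs /eqP m0]|/andP[/eqP xt]].
  case: (boolP (#|D e| == 1)) => [/cards1P[a Da]|h]; last by case: ex.
  by exists a; left.
by rewrite eqSS => /eqP ->; exists (b e); right.
Qed.

(** * Distances between codes *)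

Lemma hamming_far s t :
  1 < hamming (code s) (code t) -> ~~ point_adj s t ->
  (hamming (code s) (code t) == 1) = point_adj s t.
Proof. by move=> h /negbTE ->; rewrite gtn_eqF. Qed.

Lemma vertex_path_dist x e m : m <= n -> ~ exceptional (inl x) (inr (e, m)) ->
  (hamming (code (inl x)) (code (inr (e, m))) == 1)
  = point_adj (inl x) (inr (e, m)).
Proof.
move=> mn ex; case: (path_code_shape e mn) => [[i [j [ij oi oj]]]|[u [a ea]]].
  apply: hamming_far.
    by apply: (hamming_gt1 ij); apply: own_neq_inl; eassumption.
  apply/negP => /(adj_is_end ex)[a /is_end_code[_ ha]].
  case: (eqVneq i a) => ia; last by rewrite ha in oi.
  by rewrite ha // in oj; rewrite -ia eq_sym.
have [oa ha] := is_end_code ea.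
case: (eqVneq x u) => [xu|xu].
  have -> : hamming (code (inl x)) (code (inr (e, m))) = 1.
    apply: (hamming_eq1 (i := a)); first exact: own_neq_inl oa.
    by move=> j ja /=; rewrite ha // xu.
  by rewrite (is_end_adj _ ea) xu !eqxx.
have [j ja] := other_coord a.
apply: hamming_far; last by rewrite (is_end_adj _ ea).
apply: (hamming_gt1 ja); last exact: own_neq_inl oa.
by rewrite /= ha //; apply: contra xu => /eqP[->].
Qed.

(** Two ends with different directions differ in both of these. With the same direction they are
    attached to different vertices, as the pair is not exceptional, and so differ in every other
    coordinate too. *)
Lemma path_path_dist e m e' m' : e != e' -> m <= n -> m' <= n ->
  ~ exceptional (inr (e, m)) (inr (e', m')) ->
  1 < hamming (path_code e m) (path_code e' m').
Proof.
move=> ee' mn mn' ex.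
case: (path_code_shape e mn) => [[i [j [ij oi oj]]]|[u [a ea]]].
  by apply: (hamming_gt1 ij); apply: own_path_neq; eassumption.
case: (path_code_shape e' mn') => [[i [j [ij oi oj]]]|[u' [a' ea']]].
  rewrite eq_sym in ee'.
  rewrite hammingC; apply: (hamming_gt1 ij); apply: own_path_neq; eassumption.
have [oa ha] := is_end_code ea; have [oa' ha'] := is_end_code ea'.
have na := own_path_neq m' a ee' oa.
case: (eqVneq a' a) => [aa'|aa'].
  subst a'; have [j ja] := other_coord a.
  apply: (hamming_gt1 ja) => //; rewrite ha // ha' //.
  apply/eqP => -[uu]; apply: ex; split=> //.
  by exists u, a; split=> //; rewrite uu.
apply: (hamming_gt1 aa') => //; rewrite eq_sym.
by apply: (own_path_neq _ _ _ oa'); rewrite eq_sym.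
Qed.

(** From number 1 on, each step sets one further coordinate to the target for good, so numbers that
    are not consecutive differ in two coordinates. The step from 0 to 1 changes [pivot e] alone. *)
Lemma path_dist e m m' : m < m' <= n ->
  0 < hamming (path_code e m) (path_code e m') /\
  (hamming (path_code e m) (path_code e m') == 1) = (m' == m.+1).
Proof.
case/andP=> mm' m'n.
have tgtN t i : t < (r e i).+2 -> path_code e t i != inl (tgt e).
  move=> h; rewrite /path_code leqNgt h /=.
  by do !case: ifP => _ //; apply: contra (src_tgt e) => /eqP[->].
have tgtE t i : (r e i).+2 <= t -> path_code e t i = inl (tgt e).
  by rewrite /path_code => ->.
have r_pivot : n <= (r e (pivot e)).+2.
  by rewrite /pivot; case: ifP => _; rewrite ?r_c // r_b.
have pivot0 t : 0 < t -> path_code e 0 (pivot e) != path_code e t (pivot e).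
  move=> t0; rewrite path_code0 /path_code t0 eqxx /=.
  do 2![case: ifP => _]; apply/eqP => // -[/eqP].
  by rewrite (negbTE (src_tgt e)).
case: (posnP m) mm' => [->|m0] mm'.
  case: (ltngtP m' 1) mm' m'n => // [m'1 _|-> _] m'n; last first.
    have -> // : hamming (path_code e 0) (path_code e 1) = 1.
    apply: (hamming_eq1 (pivot0 1 _)) => // i ip.
    by rewrite path_code0 /path_code /= (negbTE ip).
  (* The coordinate of rank 0 has reached the target by number 2, and it is not the pivot, whose
     rank is at least [n - 2 > 0]. *)
  have [i ri] := @r_surj e 0 (leq_trans (isT : 0 < 3) n_ge3).
  have pi : i != pivot e.
    by apply/eqP => ip; move: r_pivot; rewrite -ip ri leqNgt n_ge3.
  have h : 1 < hamming (path_code e 0) (path_code e m').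
    apply: (hamming_gt1 pi); last by apply: pivot0; apply: ltnW.
    by rewrite [X in _ != X]tgtE ?ri // tgtN.
  by split; [exact: ltnW|rewrite !gtn_eqF].
have step t : m <= t.+1 < m' -> exists i, r e i = t :> nat /\
    path_code e m i != path_code e m' i.
  case/andP=> mt tm'; have [i ri] := @r_surj e t (ltnW (leq_trans tm' m'n)).
  by exists i; split=> //; rewrite (tgtE m') ?tgtN ?ri.
case: m m0 mm' step {tgtN tgtE pivot0} => // m _ mm' step.
have [|i [ri di]] := step m; first by rewrite leqnn.
case: (ltngtP m'.-1 m.+1) => mm2.
- by have := mm'; rewrite -(ltn_predK mm') ltnS leqNgt mm2.
- have m2m' : m.+2 < m' by rewrite -(ltn_predK mm').
  have [|j [rj dj]] := step m.+1; first by rewrite leqnSn.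
  have ij : i != j by apply/eqP => ij; move: ri; rewrite ij rj => /esym/n_Sn.
  have h := hamming_gt1 ij di dj.
  by split; [exact: ltnW|rewrite !gtn_eqF].
have -> : m' = m.+2 by rewrite -mm2 (ltn_predK mm').
have -> // : hamming (path_code e m.+1) (path_code e m.+2) = 1.
  apply: (hamming_eq1 (i := i)); first by move: di; rewrite -mm2 (ltn_predK mm').
  move=> j ji; rewrite /path_code /= !ltnS [in RHS]leq_eqVlt.
  case: (eqVneq (r e j : nat) m) => //= rj.
  by case/eqP: ji; apply: (@r_inj e); apply: val_inj; rewrite /= rj ri.
by rewrite !eqxx.
Qed.

Lemma code_dist X Y : valid X -> valid Y -> X != Y -> ~ exceptional X Y ->
  (hamming (code X) (code Y) == 1) = point_adj X Y.
Proof.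
case: X Y => [x|[e m]] [y|[e' m']] vX vY XY ex.
- have n0 : 0 < n by apply: leq_trans n_ge3.
  have [j ja] := other_coord (Ordinal n0).
  by apply: hamming_far => //; apply: (hamming_gt1 ja).
- exact: vertex_path_dist.
- by rewrite hammingC point_adjC; apply: vertex_path_dist.
- case: (eqVneq e e') => [ee'|ee']; last first.
    apply: hamming_far; last by rewrite /= (negbTE ee').
    exact: path_path_dist.
  subst e'; rewrite /= eqxx /=.
  case: (ltngtP m m') => mm'; last by rewrite mm' eqxx in XY.
    rewrite (path_dist e _).2 ?mm' //.
    by rewrite [m == _]ltn_eqF ?orbF // ltnW.
  rewrite hammingC (path_dist e _).2 ?mm' //.
  by rewrite [m' == _]ltn_eqF // ltnW.
Qed.

(** Yields injectivity on the exceptional pairs as well: a single private label separates an inner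
    vertex from everything off its path. *)
Lemma code_neq X Y : valid X -> valid Y -> X != Y ->
  0 < hamming (code X) (code Y).
Proof.
have n0 : 0 < n by apply: leq_trans n_ge3.
have own_ex e m : m <= n -> exists i, own e (path_code e m i).
  case/(path_code_shape e) => [[i [j [_ oi _]]]|[u [a /is_end_code[oa _]]]].
    by exists i.
  by exists a.
case: X Y => [x|[e m]] [y|[e' m']] vX vY XY.
- by apply: (@hamming_gt0 _ _ _ _ (Ordinal n0)); apply: contra XY => /eqP[->].
- have [i oi] := own_ex e' m' vY.
  exact: hamming_gt0 (own_neq_inl _ oi).
- have [i oi] := own_ex e m vX; rewrite hammingC.
  exact: hamming_gt0 (own_neq_inl _ oi).
- have [i oi] := own_ex e m vX.
  case: (eqVneq e e') => [ee'|ee']; last first.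
    exact: hamming_gt0 (own_path_neq _ _ ee' oi).
  subst e'; case: (ltngtP m m') => mm'; last by rewrite mm' eqxx in XY.
    by apply: (path_dist e _).1; rewrite mm'.
  by rewrite hammingC; apply: (path_dist e _).1; rewrite mm'.
Qed.

End Code.

(** * Choosing the order in which coordinates are set *)

Lemma set2_inj (T : finType) (x : T) : injective (fun y => [set x; y]).
Proof.
move=> y z /setP h; have := h y; have := h z.
by rewrite !inE !eqxx !orbT => /orP[]/eqP -> /esym/orP[]/eqP.
Qed.

Lemma set2_eq (T : finType) (x y z t : T) :
  [set x; y] = [set z; t] -> x = z /\ y = t \/ x = t /\ y = z.
Proof.
move=> h; have : x \in [set z; t] by rewrite -h set21.
rewrite !inE => /orP[]/eqP xe; rewrite -{}xe in h *.
  by left; split=> //; apply: set2_inj h.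
by right; split=> //; apply: (@set2_inj _ x); rewrite h setUC.
Qed.

(** An arbitrary bijection is corrected by two transpositions. The condition on [q] lapses if
    [p' = q'], as happens in a coordinate where two given tuples agree. *)
Lemma two_point_bij (A B : finType) (p q : A) (p' q' : B) :
  #|A| = #|B| -> p != q ->
  exists f : A -> B, [/\ injective f, f p = p' & p' != q' -> f q = q'].
Proof.
move=> AB pq; pose g x := enum_val (cast_ord AB (enum_rank x)).
have g_inj : injective g.
  by move=> x y /enum_val_inj/cast_ord_inj/enum_rank_inj.
pose g1 x := tperm (g p) p' (g x).
have g1_inj : injective g1 by move=> x y /perm_inj/g_inj.
have g1p : g1 p = p' by rewrite /g1 tpermL.
case: (eqVneq p' q') => pq'; first by exists g1; rewrite g1p.
exists (fun x => tperm (g1 q) q' (g1 x)); split.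
- by move=> x y /perm_inj/g1_inj.
- by rewrite g1p tpermD // 1?eq_sym // -g1p (inj_eq g1_inj).
- by rewrite tpermL.
Qed.

Lemma exists_code (V : eqType) (E : finType) (src tgt : E -> V) (n : nat)
    (D : E -> {set 'I_n}) (b : E -> 'I_n) :
    2 < n -> (forall e, src e != tgt e) -> (forall e, D e != set0) ->
  exists C : point V E -> 'I_n -> V + E * bool,
  [/\ forall x i, C (inl x) i = inl x,
      forall e i, C (inr (e, 0)) i =
        if i \in D e then inr (e, false) else inl (src e)
    & forall X Y, valid n.+1 X -> valid n.+1 Y -> X != Y ->
        0 < hamming (C X) (C Y) /\
        (~ exceptional src tgt D b X Y ->
         (hamming (C X) (C Y) == 1) = point_adj src tgt n.+1 X Y)].
Proof.
move=> n3 st D0.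
have nP i : i < 2 -> n - i.+1 < n.
  by move=> _; rewrite ltn_subrL (leq_trans _ n3).
pose bT := Ordinal (nP 0 isT); pose cT := Ordinal (nP 1 isT).
have bTE : bT.+1 = n by rewrite /= subn1 prednK // (leq_trans _ n3).
have cTE : cT.+2 = n.
  by rewrite /= subnS subn1 !prednK ?ltn_predRL // (leq_trans _ n3).
have bcT : bT != cT by rewrite -val_eqE /= -eqSS bTE -[X in X == _]cTE gtn_eqF.
have ranks e : exists cr : 'I_n * ('I_n -> 'I_n),
    [/\ injective cr.2, cr.2 (b e) = bT, cr.2 cr.1 = cT
      & (b e \in D e) || (cr.1 \in D e)].
  (* If [b e] is not in [D e], then [c] is taken from the nonempty [D e]; otherwise any other
     coordinate will do. *)
  have [c bc cD] : exists2 c, b e != c & (b e \in D e) || (c \in D e).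
    case: (boolP (b e \in D e)) => bD.
      by have [c cb] := other_coord n3 (b e); exists c; rewrite // eq_sym.
    have /set0Pn[c cD] := D0 e.
    by exists c => //; apply: contra bD => /eqP ->.
  have [r [r_inj rb rc]] := two_point_bij bT cT (erefl #|'I_n|) bc.
  by exists (c, r); split=> //; apply: rc.
have [cr hcr] := fin_all_exists ranks.
exists (code src tgt D b (fun e => (cr e).1) (fun e => (cr e).2)); split=> //.
move=> X Y vX vY XY.
have h : forall e, injective (cr e).2 by move=> e; have [] := hcr e.
have h1 : forall e, ((cr e).2 (b e)).+1 = n by move=> e; have [_ ->] := hcr e.
have h2 : forall e, ((cr e).2 (cr e).1).+2 = n.
  by move=> e; have [_ _ ->] := hcr e.
have h3 : forall e, (b e \in D e) || ((cr e).1 \in D e).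
  by move=> e; have [] := hcr e.
split.
  exact: (@code_neq _ _ src tgt n D b (fun e => (cr e).1) (fun e => (cr e).2)).
exact: (@code_dist _ _ src tgt n D b (fun e => (cr e).1) (fun e => (cr e).2)).
Qed.

(** * Orientations, and subdivisions as sets of points *)

Definition edge (H : sgraph) := {e : {set H} | e \in edges H}.

Lemma edge_ofP (H : sgraph) (x y : H) : adj x y ->
  exists e : edge H, val e = [set x; y].
Proof.
move=> xy; have h : [set x; y] \in edges H.
  by rewrite inE; apply/existsP; exists x; apply/existsP; exists y; rewrite xy /=.
by exists (Sub [set x; y] h).
Qed.

Definition oriented (H : sgraph) (src tgt : edge H -> H) : Prop :=
  forall e : edge H, adj (src e) (tgt e) /\ val e = [set src e; tgt e].

(** Edges at [v] leave [v], so their paths start there with the first step, the one that may change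
    any nonempty set of coordinates. *)
Lemma exists_orientation (H : sgraph) (v : H) :
  exists src tgt : edge H -> H,
    oriented src tgt /\ forall e : edge H, v \in val e -> src e = v.
Proof.
have h (e : edge H) : exists st : H * H,
    [/\ adj st.1 st.2, val e = [set st.1; st.2] & v \in val e -> st.1 = v].
  have := valP e; rewrite inE => /existsP[x /existsP[y /andP[xy /eqP exy]]].
  case: (eqVneq v y) => [->|vy].
    by exists (y, x); rewrite adj_sym exy setUC.
  exists (x, y); rewrite exy; split=> //=.
  by rewrite !inE (negbTE vy) orbF => /eqP.
have [st hst] := fin_all_exists h.
exists (fun e => (st e).1), (fun e => (st e).2).
by split=> e; have [] := hst e.
Qed.

Lemma subdivision_points (k : nat) (H H' : sgraph) (src tgt : edge H -> H) :
    0 < k -> oriented src tgt -> is_subdivision k H H' ->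
  exists rho : point H (edge H) -> H',
  [/\ forall w, exists X, valid k X /\ w = rho X,
      forall X Y, valid k X -> valid k Y -> rho X = rho Y -> X = Y
    & forall X Y, valid k X -> valid k Y ->
        adj (rho X) (rho Y) = point_adj src tgt k X Y].
Proof.
move=> k0 ori [f [V [[f_inj fV V_disj cover] [V_card V_path adj_path]]]].
pose A (e : edge H) := V (val e) :|: [set f (src e); f (tgt e)].
have path_ex (e : edge H) : exists p : seq H',
    [/\ uniq (f (src e) :: p), f (src e) :: p =i A e,
        last (f (src e)) p = f (tgt e)
      & forall i j, i < size (f (src e) :: p) -> j < size (f (src e) :: p) ->
          adj (nth (f (src e)) (f (src e) :: p) i)
              (nth (f (src e)) (f (src e) :: p) j)
          = (j == i.+1) || (i == j.+1)].
  have [ae ve] := ori e; have := V_path _ _ ae.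
  by rewrite -ve.
have [p hp] := fin_all_exists path_ex.
(* Positions 0 and [k.+1] are the ends of the path, so inner vertex number [i] has position
   [i.+1]. *)
pose q e i := nth (f (src e)) (f (src e) :: p e) i.
have sz e : size (f (src e) :: p e) = k.+2.
  have [u m _ _] := hp e; rewrite -(card_uniqP u) (eq_card m) /A.
  rewrite cardsU disjoint_setI0 ?cards0 ?subn0.
    rewrite V_card ?(valP e) // cards2 (inj_eq f_inj).
    suff -> : src e != tgt e by rewrite addn2.
    by apply/eqP => st; have [] := ori e; rewrite st adj_irrefl.
  rewrite disjoint_sym disjoints_subset; apply/subsetP => w.
  by rewrite !inE => /orP[] /eqP ->; apply: fV (valP e).
have q0 e : q e 0 = f (src e) by [].
have qk e : q e k.+1 = f (tgt e).
  have [_ _ <- _] := hp e; rewrite /q -nth_last; have := sz e.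
  by case: (p e) => [|a s] //= [->].
have q_inj e i j : i < k.+2 -> j < k.+2 -> q e i = q e j -> i = j.
  move=> ik jk; have [u _ _ _] := hp e; rewrite /q => /eqP.
  by rewrite nth_uniq ?sz // => /eqP.
have q_adj e i j : i < k.+2 -> j < k.+2 ->
    adj (q e i) (q e j) = (j == i.+1) || (i == j.+1).
  by move=> ik jk; have [_ _ _] := hp e; apply; rewrite sz.
have q_in e i : i < k.+2 -> q e i \in A e.
  by move=> ik; have [_ m _ _] := hp e; rewrite -m mem_nth // sz.
have q_V e i : i < k -> q e i.+1 \in V (val e).
  move=> ik; have /q_in : i.+1 < k.+2 by rewrite ltnS ltnW.
  move/(_ e); rewrite !inE => /orP[//|/orP[]/eqP].
    by rewrite -q0 => /q_inj; rewrite ltnS ltnW // => /(_ isT isT).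
  rewrite -qk => /q_inj; rewrite !ltnS leqnn ltnW // => /(_ isT isT)[ik'].
  by rewrite ik' ltnn in ik.
have q_surj e w : w \in A e -> exists2 i, i < k.+2 & w = q e i.
  have [_ m _ _] := hp e; rewrite -m => wq; exists (index w (f (src e) :: p e)).
    by rewrite -(sz e) index_mem.
  by rewrite /q nth_index.
pose rho (X : point H (edge H)) :=
  match X with inl x => f x | inr (e, i) => q e i.+1 end.
have rho_inj X Y : valid k X -> valid k Y -> rho X = rho Y -> X = Y.
  case: X Y => [x|[e i]] [y|[e' j]] /= vX vY h.
  - by rewrite (f_inj _ _ h).
  - by have := fV x _ (valP e'); rewrite h q_V.
  - by have := fV y _ (valP e); rewrite -h q_V.
  - case: (eqVneq e e') => [ee'|ee'].
      by subst e'; have [->] := q_inj e i.+1 j.+1 (ltnW vX) (ltnW vY) h.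
    rewrite -(inj_eq val_inj) in ee'.
    have /pred0P/(_ (q e i.+1)) := V_disj _ _ (valP e) (valP e') ee'.
    by rewrite /= q_V // h q_V.
(* The position of [X] on the path of [e]; a relation, since [X] may lie on several paths and off
   this one. *)
pose on e (X : point H (edge H)) i : Prop :=
  match X with
  | inl x => x = src e /\ i = 0 \/ x = tgt e /\ i = k.+1
  | inr (e', i') => e' = e /\ i = i'.+1
  end.
have on_rho e X i : valid k X -> on e X i -> rho X = q e i /\ i < k.+2.
  case: X => [x _ [[-> ->]|[-> ->]]|[e' i'] /= vi [-> ->]].
  - by [].
  - by rewrite qk.
  - by rewrite ltnS ltnW.
have on_ex e X : valid k X -> rho X \in A e -> exists i, on e X i.
  move=> vX /q_surj[i]; case: i => [|i] ik h.
    exists 0; rewrite (rho_inj X (inl (src e)) vX) //=; by left.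
  case: (ltnP i k) => ik'.
    by exists i.+1; rewrite (rho_inj X (inr (e, i)) vX).
  have {}ik : i = k by apply/eqP; rewrite eqn_leq ik' andbT.
  exists k.+1; rewrite (rho_inj X (inl (tgt e)) vX) //=; first by right.
  by rewrite h ik qk.
exists rho; split=> //.
  move=> w; case: (cover w) => [[x ->]|[e eH we]]; first by exists (inl x).
  have [|i ik ->] := q_surj (Sub e eH : edge H) w; first by rewrite inE we.
  case: i ik => [|i] ik; first by exists (inl (src (Sub e eH : edge H))).
  case: (ltnP i k) => ik'; first by exists (inr (Sub e eH : edge H, i)).
  have -> : i = k by apply/eqP; rewrite eqn_leq ik' andbT.
  by exists (inl (tgt (Sub e eH : edge H))); rewrite qk.
move=> X Y vX vY; apply/idP/idP => [aXY|].
  (* The last condition on subdivisions puts both vertices on one path, where adjacency means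
     consecutive positions. *)
  have [x [y [xy inX inY]]] := adj_path _ _ aXY.
  have [e ve] := edge_ofP xy.
  have Ae : V [set x; y] :|: [set f x; f y] = A e.
    rewrite /A; have [_ h] := ori e; rewrite ve in h *; congr (_ :|: _).
    by case: (set2_eq h) => -[<- <-] //; rewrite setUC.
  rewrite Ae in inX inY.
  have [i oi] := on_ex _ _ vX inX; have [j oj] := on_ex _ _ vY inY.
  have [rX ik] := on_rho _ _ _ vX oi; have [rY jk] := on_rho _ _ _ vY oj.
  move: aXY; rewrite rX rY q_adj //.
  case: X Y oi oj vX vY {inX inY rX rY} => [x'|[e1 i1]] [y'|[e2 i2]] /=.
  - by case=> -[_ ->] [] [_ ->]; rewrite //= ?eqSS ?(gtn_eqF k0) ?ltn_eqF.
  - move=> [[-> ->]|[-> ->]] [-> ->] _ vY; rewrite eqxx /=.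
      by rewrite orbF eqSS => ->.
    case/orP => /eqP[h]; last by rewrite -h eqxx orbT.
    by move: vY; rewrite h ltnNge leqnSn.
  - move=> [-> ->] [[-> ->]|[-> ->]] vX _; rewrite eqxx /=.
      by rewrite eqSS => ->.
    case/orP => /eqP[h]; first by rewrite -h eqxx orbT.
    by move: vX; rewrite h ltnNge leqnSn.
  - by move=> [-> ->] [-> ->]; rewrite eqxx !eqSS.
have conv e i j : on e X i -> on e Y j -> (j == i.+1) || (i == j.+1) ->
    adj (rho X) (rho Y).
  move=> /(on_rho _ _ _ vX)[-> ik] /(on_rho _ _ _ vY)[-> jk] h.
  by rewrite q_adj.
case: X Y vX vY conv => [x|[e i]] [y|[e' j]] //= vX vY conv.
- case/orP => /andP[/eqP xs /eqP j0].
    by apply: (conv e' 0 j.+1); [left| |rewrite j0].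
  by apply: (conv e' k.+1 j.+1); [right| |rewrite -j0 eqxx orbT].
- case/orP => /andP[/eqP xs /eqP j0].
    by apply: (conv e i.+1 0); [|left|rewrite j0].
  by apply: (conv e i.+1 k.+1); [|right|rewrite -j0 eqxx].
- by case/andP => /eqP ee' ij; subst e'; apply: (conv e i.+1 j.+1).
Qed.

(** * Colourings, embeddings and neighbourhoods in the product *)

Lemma exists_coloring (T : finType) (A : {set T}) (n : nat) :
  0 < n -> #|A| <= n -> exists c : T -> 'I_n, {in A &, injective c}.
Proof.
case: n => // n _ An; exists (fun x => inord (index x (enum A))).
have lt x : x \in A -> index x (enum A) < n.+1.
  by move=> xA; apply: leq_trans An; rewrite cardE index_mem mem_enum.
move=> x y xA yA /(congr1 val) /=; rewrite !inordK ?lt // => xy.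
rewrite -mem_enum in xA; rewrite -mem_enum in yA.
by rewrite -(nth_index x xA) xy nth_index.
Qed.

Lemma induced_sub_inj (H G : sgraph) (g : H -> G) :
  injective g -> (forall x y, adj (g x) (g y) = adj x y) -> induced_sub H G.
Proof.
move=> g_inj g_adj; exists [set g x | x in H].
have gA x : g x \in [set g x | x in H] by apply: imset_f.
exists (fun x => Sub (g x) (gA x)); split.
  apply: inj_card_bij; first by move=> x y /(congr1 val)/g_inj.
  rewrite card_sig; apply/eq_leq/(etrans _ (card_imset H g_inj)).
  exact: eq_card.
by move=> x y; rewrite -g_adj.
Qed.

Lemma hamming_relabel (n : nat) (L L' : eqType) (f : 'I_n -> L -> L')
    (s t : 'I_n -> L) : (forall i, injective (f i)) ->
  hamming (fun i => f i (s i)) (fun i => f i (t i)) = hamming s t.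
Proof.
by move=> f_inj; apply: eq_card => i; rewrite !inE (inj_eq (f_inj i)).
Qed.

Lemma clique_product_adjE (n k : nat) (s t : clique_product n k) :
  adj s t = (hamming (tnth s) (tnth t) == 1).
Proof. by []. Qed.

Lemma clique_nbhd_claw (n k : nat) (T : finType) (A : {set T})
    (z : clique_product n k) (g : T -> clique_product n k) :
  n < #|A| -> (forall u, u \in A -> adj z (g u)) ->
  exists u w, [/\ u \in A, w \in A, u != w & (g u == g w) || adj (g u) (g w)].
Proof.
move=> An zg.
have n0 : 0 < n.
  have /card_gt0P[u uA] : 0 < #|A| by apply: leq_ltn_trans An.
  have /eqP/eqP/cards1P[i _] : adj z (g u) := zg u uA.
  by apply: leq_ltn_trans (ltn_ord i).
pose i0 := Ordinal n0.
(* [i0] is a mere default: for [u] in [A] a differing coordinate exists. *)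
pose d u := odflt i0 [pick i | tnth z i != tnth (g u) i].
have dP u i : u \in A -> i != d u -> tnth z i = tnth (g u) i.
  move=> uA; have /cards1P[j hj] : adj z (g u) := zg u uA.
  have mj i' : (tnth z i' != tnth (g u) i') = (i' == j).
    by move/setP/(_ i'): hj; rewrite !inE.
  rewrite /d; case: pickP => [i1|/(_ j)]; last by rewrite mj eqxx.
  rewrite mj => /eqP -> ij; apply/eqP.
  by move: (mj i); rewrite (negbTE ij) => /negbFE.
case: (boolP (dinjectiveb d A)) => [/dinjectiveP dA|/dinjectivePn[u uA [w]]].
  move: An; rewrite -(card_in_imset dA) ltnNge.
  by rewrite (leq_trans (max_card _)) ?card_ord.
rewrite !inE => /andP[wu wA] duw; exists u, w; split; rewrite 1?eq_sym //.
have eq_uw i : i != d u -> tnth (g u) i = tnth (g w) i.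
  by move=> iu; rewrite -!dP // -duw.
case: (eqVneq (tnth (g u) (d u)) (tnth (g w) (d u))) => e.
  apply/orP; left; apply/eqP/eq_from_tnth => i.
  by case: (eqVneq i (d u)) => [->//|/eq_uw].
by apply/orP; right; rewrite clique_product_adjE (hamming_eq1 e eq_uw).
Qed.

(** * A code with a single defect at [v] *)

Section Saturation.
Variables (n : nat) (H H' : sgraph) (v u0 : H).
Hypothesis n_ge3 : 2 < n.
Hypothesis deg_v : deg v = n.+1.
Hypothesis deg_le : forall u : H, u != v -> deg u <= n.
Hypothesis v_u0 : adj v u0.
Hypothesis H'_sub : is_subdivision n.+1 H H'.

Local Notation label := (H + edge H * bool)%type.

Lemma embed (G : sgraph) (src tgt : edge H -> H) (phi : point H (edge H) -> G) :
  oriented src tgt ->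
  (forall X Y, valid n.+1 X -> valid n.+1 Y -> phi X = phi Y -> X = Y) ->
  (forall X Y, valid n.+1 X -> valid n.+1 Y -> X != Y ->
     adj (phi X) (phi Y) = point_adj src tgt n.+1 X Y) ->
  induced_sub H' G.
Proof.
move=> ori phi_inj phi_adj.
have [rho [rho_surj rho_inj rho_adj]] :=
  subdivision_points (isT : 0 < n.+1) ori H'_sub.
have [h hP] := fin_all_exists rho_surj.
apply: (@induced_sub_inj _ _ (phi \o h)).
  move=> x y; have [vx ex] := hP x; have [vy ey] := hP y.
  by move=> /(phi_inj _ _ vx vy) hxy; rewrite ex ey hxy.
move=> x y /=; have [vx ex] := hP x; have [vy ey] := hP y.
case: (eqVneq x y) => [->|xy]; first by rewrite !adj_irrefl.
rewrite phi_adj //; first by rewrite [in RHS]ex [in RHS]ey rho_adj.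
by apply: contra xy => /eqP hxy; rewrite ex ey hxy.
Qed.

(* [col x y] is the direction in which the path of the edge xy leaves x. *)
Lemma exists_half_edge_coloring : exists col : H -> H -> 'I_n,
  (forall x y z, adj x y -> adj x z -> (x == v) ==> (y != u0) && (z != u0) ->
     col x y = col x z -> y = z) /\
  (forall i, exists y, [/\ adj v y, y != u0 & col v y = i]).
Proof.
have n0 : 0 < n by apply: leq_trans n_ge3.
pose N (x : H) := [set y | adj x y && ((x == v) ==> (y != u0))].
have Nv : #|N v| = n.
  have : #|[set y | adj v y]| = n.+1 by [].
  rewrite (cardsD1 u0) inE v_u0 => -[<-]; apply: eq_card => y.
  by rewrite !inE eqxx andbC.
have cN x : #|N x| <= n.
  case: (eqVneq x v) => [->|/deg_le]; first by rewrite Nv.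
  apply: leq_trans; apply: subset_leq_card; apply/subsetP => y.
  by rewrite !inE => /andP[].
have [col colP] := fin_all_exists (fun x => exists_coloring n0 (cN x)).
exists col; split.
  move=> x y z xy xz h; apply: (colP x); rewrite inE ?xy ?xz /=.
    by apply/implyP => xv; move: h; rewrite xv => /andP[].
  by apply/implyP => xv; move: h; rewrite xv => /andP[].
(* Without [u0] exactly [n] neighbours of [v] are left, so the injective choice uses every
   direction. *)
move=> i; have : i \in [set col v y | y in N v].
  suff -> : [set col v y | y in N v] = setT by rewrite inE.
  apply/eqP; rewrite eqEcard subsetT (card_in_imset (colP v)) Nv.
  by rewrite cardsT card_ord leqnn.
by case/imsetP => y; rewrite inE eqxx /= => /andP[vy yu] ->; exists y.
Qed.

(* D0 is the set of coordinates changed by the first step of the path of vu0. *)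
Lemma exists_code_at_vertex (D0 : {set 'I_n}) : D0 != set0 ->
  exists (src tgt : edge H -> H) (f0 : edge H)
    (C : point H (edge H) -> 'I_n -> label),
  [/\ oriented src tgt, src f0 = v,
      forall x i, C (inl x) i = inl x,
      forall i, C (inr (f0, 0)) i = if i \in D0 then inr (f0, false) else inl v
    & forall X Y, valid n.+1 X -> valid n.+1 Y -> X != Y ->
        0 < hamming (C X) (C Y)]
  /\
  ((1 < #|D0| -> forall X Y, valid n.+1 X -> valid n.+1 Y -> X != Y ->
      (X, Y) != (inl v, inr (f0, 0)) -> (X, Y) != (inr (f0, 0), inl v) ->
      (hamming (C X) (C Y) == 1) = point_adj src tgt n.+1 X Y) /\
   (forall i0, D0 = [set i0] -> exists f1 : edge H,
      [/\ f1 != f0,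
          forall i, C (inr (f1, 0)) i =
            if i \in D0 then inr (f1, false) else inl v
        & forall X Y, valid n.+1 X -> valid n.+1 Y -> X != Y ->
          (X, Y) != (inr (f0, 0), inr (f1, 0)) ->
          (X, Y) != (inr (f1, 0), inr (f0, 0)) ->
          (hamming (C X) (C Y) == 1) = point_adj src tgt n.+1 X Y])).
Proof.
move=> D0n; have [src [tgt [ori srcv]]] := exists_orientation v.
have [f0 ef0] := edge_ofP v_u0.
have [col [col_inj col_surj]] := exists_half_edge_coloring.
have sv (e : edge H) y :
    adj v y -> val e = [set v; y] -> src e = v /\ tgt e = y.
  move=> vy ee; have se : src e = v by apply: srcv; rewrite ee set21.
  split=> //; have [_] := ori e; rewrite se ee => /set2_inj //.
have [sf0 tf0] := sv _ _ v_u0 ef0.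
(* The path of [f0] starts on [D0]; every other path starts, and every path ends, in the direction
   of its half-edge. *)
pose D e := if e == f0 then D0 else [set col (src e) (tgt e)].
pose b e := col (tgt e) (src e).
have st e : src e != tgt e.
  by apply/eqP => h; have [] := ori e; rewrite h adj_irrefl.
have D_n0 e : D e != set0.
  by rewrite /D; case: ifP => // _; rewrite -card_gt0 cards1.
have [C [C0 C1 C2]] := exists_code b n_ge3 st D_n0.
(* An end is either the start of the path of [f0], with [D0] a singleton, or belongs to a half-edge
   from [u] to [w], not the one from [v] to [u0], and has direction [col u w]. *)
have endP e m u a : is_end src tgt D b e m u a ->
    [/\ e = f0, m = 0, u = v & D0 = [set a]] \/
    exists w, [/\ adj u w, val e = [set u; w], (u == v) ==> (w != u0),
                a = col u w & u = v -> m = 0].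
  have [ae ve] := ori e.
  have tv : tgt e != v.
    apply/eqP => te; have : src e = v by apply: srcv; rewrite ve te set22.
    by move=> se; have := st e; rewrite se te eqxx.
  case=> [[-> [-> Da]]|[-> [-> ->]]].
    move: Da; rewrite /D; case: (eqVneq e f0) => [->|ef] Da.
      by left; rewrite sf0.
    right; exists (tgt e); split=> //; last by apply: set1_inj.
    apply/implyP => /eqP se; apply: contra ef => /eqP te; apply/eqP/val_inj.
    by rewrite ve se te.
  right; exists (src e); split; rewrite ?(negbTE tv) //.
  - by rewrite adj_sym.
  - by rewrite setUC.
  - by move=> h; rewrite h eqxx in tv.
(* Coloured half-edges at a vertex have distinct directions, so one end of an exceptional pair must
   be the start of the path of [f0]. *)
have excP e m e' m' : exceptional src tgt D b (inr (e, m)) (inr (e', m')) ->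
  exists a, D0 = [set a] /\ (exists w, [/\ adj v w, w != u0, a = col v w,
     m = 0 /\ m' = 0
     & e = f0 /\ val e' = [set v; w] \/ e' = f0 /\ val e = [set v; w]]).
  case=> ee' [u [a [/endP he /endP he']]].
  case: he he' => [[e0 m0 uv Da]|[w [uw ew wu aw uv]]].
    case=> [[e'0 _ _ _]|[w [uw ew wu aw uv']]].
      by rewrite e0 e'0 eqxx in ee'.
    exists a; split=> //; exists w; rewrite uv in uw ew wu aw uv' *.
    by rewrite eqxx in wu; split=> //; [rewrite uv'|left].
  case=> [[e0 m0 uv' Da]|[w' [uw' ew' wu' aw' uv']]].
    exists a; split=> //; exists w; rewrite uv' in uw ew wu aw uv *.
    by rewrite eqxx in wu; split=> //; [rewrite uv|right].
  case/eqP: ee'; apply: val_inj; rewrite ew ew'; congr [set u; _].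
  apply: (col_inj u) => //; last by rewrite -aw.
  by apply/implyP => h; rewrite (implyP wu h) (implyP wu' h).
have vexc e m x : exceptional src tgt D b (inl x) (inr (e, m)) ->
    [/\ x = v, e = f0, m = 0 & #|D0| != 1].
  case=> -> ->; rewrite /D; case: (eqVneq e f0) => [->|_]; last by rewrite cards1.
  by rewrite sf0.
exists src, tgt, f0, C; split; first split=> //.
- by move=> i; rewrite C1 /D eqxx sf0.
- by move=> X Y vX vY /(C2 _ _ vX vY)[].
split.
  move=> D1 X Y vX vY XY n1 n2; apply: (C2 _ _ vX vY XY).2.
  case: X Y {vX vY XY} n1 n2 => [x|[e m]] [y|[e' m']] n1 n2 //.
  - by case/vexc => xv ef m0 _; rewrite xv ef m0 eqxx in n1.
  - by case/exceptionalC/vexc => xv ef m0 _; rewrite xv ef m0 eqxx in n2.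
  - by case/excP => a [Da _]; rewrite Da cards1 in D1.
(* [u1] is the neighbour of [v] whose half-edge has direction [i0]; its path is the only one that
   clashes with that of [f0]. *)
move=> i0 Di0; have [u1 [vu1 u10 cu1]] := col_surj i0.
have [f1 ef1] := edge_ofP vu1; have [sf1 tf1] := sv _ _ vu1 ef1.
have f10 : f1 != f0.
  by apply: contra u10 => /eqP h; rewrite -tf1 h tf0.
exists f1; split=> //.
  by move=> i; rewrite C1 /D (negbTE f10) sf1 tf1 cu1 Di0.
move=> X Y vX vY XY n1 n2; apply: (C2 _ _ vX vY XY).2.
case: X Y {vX vY XY} n1 n2 => [x|[e m]] [y|[e' m']] n1 n2 //.
- by case/vexc => _ _ _; rewrite Di0 cards1.
- by case/exceptionalC/vexc => _ _ _; rewrite Di0 cards1.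
case/excP => a [Da [w [vw wu aw [m0 m'0] h]]].
have wu1 : w = u1.
  apply: (col_inj v) => //; first by rewrite eqxx wu u10.
  by rewrite cu1 -aw; apply: set1_inj; rewrite -Da.
case: h => -[ef ew]; rewrite wu1 -ef1 in ew; have {}ew := val_inj ew.
  by rewrite ef ew m0 m'0 eqxx in n1.
by rewrite ef ew m0 m'0 eqxx in n2.
Qed.

(** * Copies after deleting or adding an edge *)

Local Notation k := #|{: label}|.

(** Injective relabelling in each coordinate preserves Hamming distances and can move a pair of
    codes onto a prescribed pair of tuples. The product has as many letters as there are labels. *)
Definition relabel (sigma : 'I_n -> label -> 'I_k)
    (C : point H (edge H) -> 'I_n -> label) (X : point H (edge H)) : clique_product n k :=
  [tuple sigma i (C X i) | i < n].

Lemma relabel_hamming sigma C X Y : (forall i, injective (sigma i)) ->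
  hamming (tnth (relabel sigma C X)) (tnth (relabel sigma C Y))
  = hamming (C X) (C Y).
Proof.
move=> sigma_inj; rewrite -(hamming_relabel _ _ sigma_inj).
by apply: eq_card => i; rewrite !inE !tnth_mktuple.
Qed.

Lemma relabel_inj sigma C (P : pred (point H (edge H))) :
    (forall i, injective (sigma i)) ->
    (forall X Y, P X -> P Y -> X != Y -> 0 < hamming (C X) (C Y)) ->
  forall X Y, P X -> P Y -> relabel sigma C X = relabel sigma C Y -> X = Y.
Proof.
move=> sigma_inj C_neq X Y PX PY e; apply/eqP; apply: contraT.
move/(C_neq _ _ PX PY); rewrite -(relabel_hamming C X Y sigma_inj) e.
by case/card_gt0P => i; rewrite inE eqxx.
Qed.

Lemma delete_edge_case (x y : clique_product n k) :
  adj x y -> induced_sub H' (delete_edge [set x; y]).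
Proof.
move=> xy; have /cards1P[i0 D0E] := xy.
set D0 := [set i | _] in D0E.
have xyi i : i != i0 -> tnth x i = tnth y i.
  by move=> ii; apply/eqP; move/setP/(_ i): D0E; rewrite !inE (negbTE ii) => /negbFE.
have D0n : D0 != set0 by rewrite D0E -card_gt0 cards1.
have [src [tgt [f0 [C [[ori sf0 C0 C1 C_neq] [_ /(_ i0 D0E)]]]]]] :=
  exists_code_at_vertex D0n.
case=> f1 [f10 C1' C_adj].
(* In direction [i0] the private labels of the two paths go to the entries of [x] and [y]; elsewhere
   [v] goes to their common entry. *)
have sigma_ex i : exists s : label -> 'I_k, [/\ injective s,
    i != i0 -> s (inl v) = tnth x i,
    i == i0 -> s (inr (f0, false)) = tnth x i
    & i == i0 -> s (inr (f1, false)) = tnth y i].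
  case: (eqVneq i i0) => [->|ii].
    have ne : inr (f0, false) != inr (f1, false) :> label.
      by apply: contra f10 => /eqP[->].
    have [s [s_inj s0 s1]] :=
      two_point_bij (tnth x i0) (tnth y i0) (esym (card_ord k)) ne.
    exists s; split=> // _; apply: s1.
    by move/setP/(_ i0): D0E; rewrite !inE eqxx.
  have ne : inl v != inr (f0, false) :> label by [].
  have [s [s_inj s0 _]] :=
    two_point_bij (tnth x i) (tnth x i) (esym (card_ord k)) ne.
  by exists s.
have [sigma sigmaP] := fin_all_exists sigma_ex.
have sigma_inj i : injective (sigma i) by have [] := sigmaP i.
pose phi := relabel sigma C.
have phi0 : phi (inr (f0, 0)) = x.
  apply: eq_from_tnth => i; rewrite tnth_mktuple C1 D0E inE.
  have [_ h1 h2 _] := sigmaP i; case: ifP => [/h2 //|/negbT/h1 //].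
have phi1 : phi (inr (f1, 0)) = y.
  apply: eq_from_tnth => i; rewrite tnth_mktuple C1' D0E inE.
  have [_ h1 _ h2] := sigmaP i; case: ifP => [/h2 //|/negbT ii].
  by rewrite h1 // xyi.
have phi_inj := relabel_inj sigma_inj C_neq.
apply: (@embed (delete_edge [set x; y]) _ _ phi ori phi_inj) => X Y vX vY XY.
rewrite /= /delete_edge_adj.
case: eqVneq => [|sXY] /=.
  rewrite andbF -phi0 -phi1 => /set2_eq[] [/phi_inj-> // /phi_inj-> //] /=.
    by rewrite eq_sym (negbTE f10).
  by rewrite (negbTE f10).
rewrite andbT [LHS](congr1 (fun m => m == 1) (relabel_hamming C X Y sigma_inj)).
apply: C_adj => //; apply: contra sXY => /eqP[-> ->]; first by rewrite phi0 phi1.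
by rewrite phi0 phi1 setUC.
Qed.

(** With [D0] the set of at least two coordinates where [x] and [y] differ, the codes lack one
    adjacency, that of [v] and the first inner vertex towards [u0]; relabelling puts it on the added
    edge. *)
Lemma add_edge_case (x y : clique_product n k) :
  x != y -> ~~ adj x y -> induced_sub H' (add_edge [set x; y]).
Proof.
move=> xy nxy.
pose D0 := [set i | tnth x i != tnth y i].
have D0n : D0 != set0.
  apply: contra xy => /eqP D0E; apply/eqP/eq_from_tnth => i.
  by move/setP/(_ i): D0E; rewrite !inE => /negbFE/eqP.
have D01 : 1 < #|D0| by rewrite ltn_neqAle eq_sym nxy card_gt0.
have [src [tgt [f0 [C [[ori sf0 C0 C1 C_neq] [/(_ D01) C_adj _]]]]]] :=
  exists_code_at_vertex D0n.
have sigma_ex i : exists s : label -> 'I_k,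
  [/\ injective s, s (inl v) = tnth x i
    & tnth x i != tnth y i -> s (inr (f0, false)) = tnth y i].
  by apply: two_point_bij; rewrite ?card_ord.
have [sigma sigmaP] := fin_all_exists sigma_ex.
have sigma_inj i : injective (sigma i) by have [] := sigmaP i.
pose phi := relabel sigma C.
have phiv : phi (inl v) = x.
  by apply: eq_from_tnth => i; rewrite tnth_mktuple C0; have [] := sigmaP i.
have phi0 : phi (inr (f0, 0)) = y.
  apply: eq_from_tnth => i; rewrite tnth_mktuple C1 inE.
  by have [_ h1 h2] := sigmaP i; case: eqVneq => [<-|/h2].
have phi_inj := relabel_inj sigma_inj C_neq.
apply: (@embed (add_edge [set x; y]) _ _ phi ori phi_inj) => X Y vX vY XY.
have phiXY : phi X != phi Y.
  by apply: contra XY => /eqP/phi_inj -> //.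
rewrite /= /add_edge_adj phiXY /=.
case: eqVneq => [|sXY] /=.
  rewrite orbT -phiv -phi0 => /set2_eq[] [/phi_inj-> // /phi_inj-> //] /=.
    by rewrite sf0 eqxx.
  by rewrite sf0 eqxx.
rewrite orbF [LHS](congr1 (fun m => m == 1) (relabel_hamming C X Y sigma_inj)).
apply: C_adj => //; apply: contra sXY => /eqP[-> ->]; first by rewrite phiv phi0.
by rewrite phiv phi0 setUC.
Qed.

(** * No induced copy in the product *)

Lemma not_induced_sub (l : nat) : ~ induced_sub H' (clique_product n l).
Proof.
case=> A [g [/bij_inj g_inj g_adj]].
have [src [tgt [ori srcv]]] := exists_orientation v.
have [rho [_ rho_inj rho_adj]] :=
  subdivision_points (isT : 0 < n.+1) ori H'_sub.
(* [e0] is a default for vertices not adjacent to [v]. *)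
have edge_ex u : exists e : edge H, adj v u -> val e = [set v; u].
  have [e0 _] := edge_ofP v_u0.
  by case: (boolP (adj v u)) => [/edge_ofP[e ee]|_]; [exists e|exists e0].
have [d dP] := fin_all_exists edge_ex.
have sd u : adj v u -> src (d u) = v.
  by move=> /dP du; apply: srcv; rewrite du set21.
pose P u : point H (edge H) := inr (d u, 0).
(* The first inner vertices of the [n + 1] paths at [v] are distinct and pairwise nonadjacent
   neighbours of [v] in [H']. *)
have := @clique_nbhd_claw n l H [set u | adj v u] (val (g (rho (inl v))))
  (fun u => val (g (rho (P u)))).
case=> [|u|u [w [uN wN uw]]]; first by have -> : #|[set u | adj v u]| = n.+1.
  rewrite inE => vu.
  rewrite -[adj _ _]/(adj (g (rho (inl v))) (g (rho (P u)))) g_adj.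
  by rewrite rho_adj //= sd // eqxx.
rewrite !inE in uN wN.
case/orP => [/eqP/val_inj/g_inj/rho_inj h|].
  have [duw] := h isT isT; have := dP w wN; rewrite -duw dP // => /set2_inj uw'.
  by rewrite uw' eqxx in uw.
rewrite -[adj _ _]/(adj (g (rho (P u))) (g (rho (P w)))) g_adj.
by rewrite rho_adj //= andbF.
Qed.

End Saturation.

(** * Saturation of the product *)

Theorem corollary3 (n : nat) (H : sgraph) (v : H) (H' : sgraph)
  (n_ge4 : 4 <= n)
  (v_max : deg v = max_degree H)
  (v_unique : forall u : H, deg u = max_degree H -> u = v)
  (max_deg : max_degree H = n + 1)
  (max_deg_del : max_degree (delete_vertex v) <= n - 1)
  (H'_sub : is_subdivision (n + 1) H H') :
  exists k : nat, 1 <= k /\ induced_saturated H' (clique_product n k).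
Proof.
rewrite addn1 in max_deg H'_sub.
have deg_v : deg v = n.+1 by rewrite v_max.
have deg_le (u : H) : u != v -> deg u <= n.
  move=> uv; rewrite -ltnS -max_deg ltn_neqAle leq_bigmax andbT.
  by apply: contra uv => /eqP/v_unique ->.
have [u0 v_u0] : exists u0 : H, adj v u0.
  have /card_gt0P[u0] : 0 < #|[set u | adj v u]|.
    by rewrite -[#|_|]/(deg v) deg_v.
  by rewrite inE; exists u0.
have n_ge3 : 2 < n by apply: ltnW.
(* Two labels give the product at least two vertices, since [k <= k ^ n]. *)
have k_ge2 : 1 < #|{: H + edge H * bool}|.
  apply/card_gt1P; exists (inl v), (inl u0); split=> //.
  by apply/eqP => -[vu]; rewrite vu adj_irrefl in v_u0.
exists #|{: H + edge H * bool}|; split; first exact: ltnW.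
split.
- rewrite card_tuple card_ord (leq_trans k_ge2) //.
  by rewrite -{1}[#|_|]expn1 leq_pexp2l 1?ltnW // ltnW.
- exact: not_induced_sub deg_v v_u0 H'_sub _.
- move=> e; rewrite inE => /existsP[x /existsP[y /andP[xy /eqP ->]]].
  exact: delete_edge_case n_ge3 deg_v deg_le v_u0 H'_sub _ _ xy.
- move=> e; rewrite inE => /existsP[x /existsP[y /andP[/andP[xy nxy] /eqP ->]]].
  exact: (add_edge_case n_ge3 deg_v deg_le v_u0 H'_sub xy nxy).
Qed.
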